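(* Assume that $f$ is bounded below by $f_{\mathrm{low}}\in\mathbb{R}$, that $f$ is Lipschitz continuous in $y$ with constant $L_f>0$ independent of $x$, i.e. $|f(x,y)-f(x,y')|\le L_f\|y-y'\|$ for all $x\in\mathbb{R}^{n_x}$, $y,y'\in\mathbb{R}^{n_y}$, and that $F$ is Lipschitz continuous with constant $L_F$. Let $\{x_k\}$ be a sequence generated by the inexact directional direct-search algorithm described in the context, with $\alpha_{\min}>0$ and $D_k=\{g_k\}$, $\|g_k\|=1$, and assume that $\{g_k\}$ is dense in the unit sphere of $\mathbb{R}^{n_x}$. Then $\{x_k\}$ is eventually constant, and its unique limit point is a $(\delta,\epsilon)$-Goldstein stationary point of $F$ for $$\epsilon=\frac{4L_f\varepsilon}{\alpha_{\min}}+c\,\alpha_{\min}\qquad\text{and}\qquad \delta=\alpha_{\min}.$$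
   Context: Bilevel setting. $f:\mathbb{R}^{n_x}\times\mathbb{R}^{n_y}\to\mathbb{R}$ is continuous, $g:\mathbb{R}^{n_x}\times\mathbb{R}^{n_y}\to\mathbb{R}$, $Z\subset\mathbb{R}^{n_y}$. For every $x\in\mathbb{R}^{n_x}$, $\arg\min_{z\in Z} g(x,z)=\{y(x)\}$ is a singleton. The true objective is $F(x):=f(x,y(x))$. A fixed oracle $\tilde y:\mathbb{R}^{n_x}\to\mathbb{R}^{n_y}$ satisfies $\|\tilde y(x)-y(x)\|\le\varepsilon$ for all $x$, where $\varepsilon>0$ is a fixed constant, and $\tilde F(x):=f(x,\tilde y(x))$. Inexact directional direct-search algorithm (no termination test). Parameters: $x_0\in\mathbb{R}^{n_x}$, stepsize lower bound $\alpha_{\min}$, initial stepsize $\alpha_0\ge\alpha_{\min}$, contraction factor $\theta\in(0,1)$, expansion factor $\gamma\ge1$, coefficient $c>0$. At each iteration $k=0,1,2,\dots$: (i) Search: choose an arbitrary finite set $S_k\subset\mathbb{R}^{n_x}$; if some $t\in S_k$ satisfies $\tilde F(t)<\tilde F(x_k)-\frac c2\alpha_k^2$, set $x_{k+1}=t$ for such a $t$, declare the iteration successful and skip the poll step. (ii) Poll: otherwise, choose a set of directions $D_k$; if some $d_k\in D_k$ satisfies $\tilde F(x_k+\alpha_kd_k)<\tilde F(x_k)-\frac c2\alpha_k^2$, set $x_{k+1}=x_k+\alpha_kd_k$ for such a $d_k$ and declare the iteration successful; otherwise set $x_{k+1}=x_k$ and declare it unsuccessful. (iii) Stepsize: if successful,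 choose any $\alpha_{k+1}\in[\alpha_k,\gamma\alpha_k]$; if unsuccessful, set $\alpha_{k+1}=\max\{\alpha_{\min},\theta\alpha_k\}$. Goldstein stationarity. For locally Lipschitz $F$, $\partial F$ denotes the Clarke subdifferential, $B_\delta(x)$ the ball of radius $\delta$ centered at $x$, and $\partial_\delta F(x)=\mathrm{conv}\big(\bigcup_{y\in B_\delta(x)}\partial F(y)\big)$. A point $x$ is $(\delta,\epsilon)$-Goldstein stationary for $F$ if there is $g\in\partial_\delta F(x)$ with $\|g\|\le\epsilon$.
   Formalization: For n_x = 1 the formal theorem additionally assumes every tail of {g_k} is dense in {-1,1} (both directions occur infinitely often); with density of the whole sequence alone the claim is false there. For n_x ≥ 2 the hypothesis is as stated. *)

(* Defs.v *)
From HB Require Import structures.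
From mathcomp Require Import all_boot all_order all_algebra.
From mathcomp Require Import all_classical all_reals all_analysis.

Set Implicit Arguments.
Unset Strict Implicit.
Unset Printing Implicit Defensive.

Import Order.TTheory GRing.Theory Num.Theory.
Import numFieldNormedType.Exports.

Local Open Scope classical_set_scope.
Local Open Scope ring_scope.

(* Points of R^n are row vectors. The library's norm `|u| on 'rV[R]_n is the
   sup norm, so the Euclidean norm is introduced separately; both induce the
   same topology, hence [continuous], [closure], [cluster] and [nbhs] below
   have their usual meaning. *)
Section Euclidean.
Context {R : realType} {n : nat}.
Implicit Types u v : 'rV[R]_n.

Definition dotv u v : R := \sum_(i < n) u ord0 i * v ord0 i.

Definition enorm u : R := Num.sqrt (dotv u u).

Definition eball (x : 'rV[R]_n) (r : R) : set 'rV[R]_n :=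
  [set z | enorm (z - x) <= r].

Definition esphere : set 'rV[R]_n := [set u | enorm u = 1].

Definition elipschitz (L : R) (F : 'rV[R]_n -> R) : Prop :=
  forall x x', `|F x - F x'| <= L * enorm (x - x').

End Euclidean.

Section Goldstein.
Context {R : realType} {n : nat}.
Implicit Types (F : 'rV[R]_n -> R) (x d s : 'rV[R]_n) (delta eps : R).

(* F°(x; d) = limsup_{z -> x, t -> 0+} (F (z + t d) - F z) / t *)
Definition clarke_dd F x d : \bar R :=
  limf_esup (fun p : 'rV[R]_n * R => ((F (p.1 + p.2 *: d) - F p.1) / p.2)%:E)
    (filter_prod (nbhs x) (0 : R)^'+).

Definition clarke_subdiff F x : set 'rV[R]_n :=
  [set s | forall d, ((dotv s d)%:E <= clarke_dd F x d)%E].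

Definition convex_hull (A : set 'rV[R]_n) : set 'rV[R]_n :=
  smallest (@convex_set R 'rV[R]_n) A.

Definition goldstein_subdiff delta F x : set 'rV[R]_n :=
  convex_hull (\bigcup_(z in eball x delta) clarke_subdiff F z).

Definition goldstein_stationary delta eps F x : Prop :=
  exists2 s, goldstein_subdiff delta F x s & enorm s <= eps.

End Goldstein.

Definition argmin {R : realType} {T : Type} (Z : set T) (h : T -> R) : set T :=
  [set z | Z z /\ forall z', Z z' -> h z <= h z'].

(* With w the lower-level solution map this is F, with w the oracle it is the
   inexact objective. *)
Definition upper_objective {R : realType} {nx ny : nat}
    (f : 'rV[R]_nx * 'rV[R]_ny -> R) (w : 'rV[R]_nx -> 'rV[R]_ny) :
    'rV[R]_nx -> R :=
  fun x => f (x, w x).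

Section DirectSearch.
Context {R : realType} {n : nat}.
Variables (Ft : 'rV[R]_n -> R) (alpha_min theta gamma c : R).

Definition sufficient_decrease (x : 'rV[R]_n) (alpha : R) (t : 'rV[R]_n) :
    Prop :=
  Ft t < Ft x - c / 2 * alpha ^+ 2.

(* One iteration (x, alpha) -> (x', alpha') with search set S and poll
   directions D. *)
Variant ds_step (S D : set 'rV[R]_n) (x : 'rV[R]_n) (alpha : R)
    (x' : 'rV[R]_n) (alpha' : R) : Prop :=
| SearchSuccess of
    S x' & sufficient_decrease x alpha x' &
    alpha <= alpha' <= gamma * alpha
| PollSuccess (d : 'rV[R]_n) of
    (forall t, S t -> ~ sufficient_decrease x alpha t) &
    D d & sufficient_decrease x alpha (x + alpha *: d) &
    x' = x + alpha *: d & alpha <= alpha' <= gamma * alpha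
| Unsuccessful of
    (forall t, S t -> ~ sufficient_decrease x alpha t) &
    (forall d, D d -> ~ sufficient_decrease x alpha (x + alpha *: d)) &
    x' = x & alpha' = Num.max alpha_min (theta * alpha).

(* Only the direction sets D k of iterations reaching the poll step matter. *)
Definition ds_run (x0 : 'rV[R]_n) (alpha0 : R) (S D : nat -> set 'rV[R]_n)
    (x : nat -> 'rV[R]_n) (alpha : nat -> R) : Prop :=
  [/\ x 0%N = x0, alpha 0%N = alpha0, forall k, finite_set (S k) &
      forall k, ds_step (S k) (D k) (x k) (alpha k) (x k.+1) (alpha k.+1)].

End DirectSearch.

(* Main.v *)
(* Sufficient decrease forces every iteration from some point on to fail with
   stepsize alpha_min at a fixed xbar, so by density and continuity
   F (xbar + alpha_min d) >= F xbar - rho for all unit d, where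
   rho = 2 L_f eps + c alpha_min^2 / 2. Then F + rho / alpha_min^2 |. - xbar|^2
   has an interior minimiser z over the ball of radius alpha_min, and Fermat's
   rule puts - (2 rho / alpha_min^2) (z - xbar), of norm at most
   2 rho / alpha_min, in the Clarke subdifferential of F at z. *)
Require Import Defs.
From mathcomp Require Import all_boot all_order all_algebra.
From mathcomp Require Import all_classical all_reals all_analysis.
From mathcomp Require Import ring lra.

Import Order.TTheory GRing.Theory Num.Theory.
Import numFieldNormedType.Exports.

Local Open Scope classical_set_scope.
Local Open Scope ring_scope.

Set Implicit Arguments.
Unset Strict Implicit.

(** * Inner product, Euclidean norm and compactness of Euclidean balls *)

Section Dot.
Context {R : realType} {n : nat}.
Implicit Types (u v w : 'rV[R]_n) (a t : R).

Lemma dotvC u v : dotv u v = dotv v u.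
Proof. by apply: eq_bigr => i _; rewrite mulrC. Qed.

Lemma dotvDl u v w : dotv (u + v) w = dotv u w + dotv v w.
Proof. by rewrite -big_split; apply: eq_bigr => i _; rewrite mxE mulrDl. Qed.

Lemma dotvZl a u v : dotv (a *: u) v = a * dotv u v.
Proof. by rewrite mulr_sumr; apply: eq_bigr => i _; rewrite mxE mulrA. Qed.

Lemma dotvDr u v w : dotv u (v + w) = dotv u v + dotv u w.
Proof. by rewrite !(dotvC u) dotvDl. Qed.

Lemma dotvZr a u v : dotv u (a *: v) = a * dotv u v.
Proof. by rewrite !(dotvC u) dotvZl. Qed.

Lemma dotvv_ge0 u : 0 <= dotv u u.
Proof. by apply: sumr_ge0 => i _; rewrite -expr2 sqr_ge0. Qed.

Lemma dotvv_gt0 u : u != 0 -> 0 < dotv u u.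
Proof.
move=> u0; rewrite lt_def dotvv_ge0 andbT; apply: contra u0.
rewrite psumr_eq0 => [/allP u0|i _]; last by rewrite -expr2 sqr_ge0.
apply/eqP/rowP => i; rewrite mxE; apply/eqP.
by have := u0 i (mem_index_enum i); rewrite mulf_eq0 orbb.
Qed.

Lemma enorm_ge0 u : 0 <= enorm u.
Proof. exact: sqrtr_ge0. Qed.

Lemma sqr_enorm u : enorm u ^+ 2 = dotv u u.
Proof. by rewrite sqr_sqrtr // dotvv_ge0. Qed.

Lemma enorm0 : enorm (0 : 'rV[R]_n) = 0.
Proof.
by rewrite /enorm /dotv big1 ?sqrtr0 // => i _; rewrite mxE mul0r.
Qed.

Lemma enormZ a u : 0 <= a -> enorm (a *: u) = a * enorm u.
Proof.
move=> a0; apply/eqP; rewrite -(@eqrXn2 _ 2%N) ?mulr_ge0 ?enorm_ge0//.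
by rewrite exprMn !sqr_enorm dotvZl dotvZr mulrA -expr2.
Qed.

Lemma norm_le_enorm u : `|u| <= enorm u.
Proof.
rewrite [leLHS]/Num.norm /= mx_normrE; apply: bigmax_le => [|[i j] _].
  exact: enorm_ge0.
rewrite -ler_sqr ?nnegrE ?enorm_ge0// sqr_enorm real_normK ?num_real//=.
rewrite /dotv (bigD1 j)//= ord1 -expr2 lerDl.
by apply: sumr_ge0 => k _; rewrite -expr2 sqr_ge0.
Qed.

Lemma cvg_dotv {T : Type} {F : set_system T} {FF : Filter F}
    {f g : T -> 'rV[R]_n} {u v} :
  f @ F --> u -> g @ F --> v -> dotv (f t) (g t) @[t --> F] --> dotv u v.
Proof.
move=> fu gv; rewrite /dotv.
elim: (index_enum _) => [|i s IH].
  rewrite big_nil; under eq_fun do rewrite big_nil; exact: cvg_cst.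
rewrite big_cons; under eq_fun do rewrite big_cons.
apply: cvgD IH; apply: cvgM.
  exact: (cvg_comp _ _ fu (@coord_continuous _ _ _ _ _ _)).
exact: (cvg_comp _ _ gv (@coord_continuous _ _ _ _ _ _)).
Qed.

Lemma continuous_enorm : continuous (@enorm R n).
Proof.
move=> u; have uu : dotv v v @[v --> u] --> dotv u u.
  by apply: (@cvg_dotv _ (nbhs u)); exact: cvg_id.
exact: (cvg_comp _ _ uu (@sqrt_continuous R _)).
Qed.

Lemma elipschitz_continuous (L : R) (F : 'rV[R]_n -> R) :
  elipschitz L F -> continuous F.
Proof.
move=> FL u.
have vu : v - u @[v --> u] --> u - u.
  by apply: (@cvgB _ _ _ (nbhs u)); [exact: cvg_id|exact: cvg_cst].
have := cvg_comp _ _ vu (@continuous_enorm (u - u)).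
rewrite subrr enorm0 => /(@cvgMl_tmp _ _ _ _ _ L _); rewrite mulr0 => LE.
suff /norm_cvg0/subr_cvg0 : `|F v - F u| @[v --> u] --> (0 : R) by [].
apply: squeeze_cvgr (@cvg_cst _ _ _ _ (nbhs_filter u)) LE.
by near=> v; rewrite normr_ge0 FL.
Unshelve. all: by end_near. Qed.

(** Bounded because the sup norm is at most [enorm]; closed as a sublevel set of a continuous
    function. *)
Lemma compact_eball u a : compact (eball u a).
Proof.
apply: bounded_closed_compact.
  exists (`|u| + a); split => [|M aM v va]; first exact: num_real.
  apply: le_trans (ltW aM); rewrite -lerBlDl.
  apply: le_trans (va : enorm (v - u) <= a).
  exact: le_trans (lerB_dist _ _) (norm_le_enorm _).
apply: (@closed_comp _ _ (fun v => enorm (v - u)) [set r | r <= a]).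
  move=> v _; have vu : w - u @[w --> v] --> v - u.
    by apply: (@cvgB _ _ _ (nbhs v)); [exact: cvg_id|exact: cvg_cst].
  exact: (cvg_comp _ _ vu (@continuous_enorm _)).
exact: closed_le.
Qed.

End Dot.

(** Excludes dimension zero, where the only vector has norm 0. *)
Lemma enorm1_dim_gt0 {R : realType} {n : nat} (u : 'rV[R]_n) :
  enorm u = 1 -> (0 < n)%N.
Proof.
case: n u => // u; rewrite /enorm /dotv big_ord0 sqrtr0 => /esym/eqP.
by rewrite oner_eq0.
Qed.

(** * Goldstein stationarity from a lower bound on a sphere *)

Section GoldsteinCriterion.
Context {R : realType} {n : nat}.
Implicit Types (F : 'rV[R]_n -> R) (x d : 'rV[R]_n) (a rho : R).

(** Every neighbourhood in the limsup contains (x, t) for small t > 0, so freezing the base point at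
    x bounds the limsup from below. *)
Lemma clarke_dd_ge F x d a (h : R -> R) :
  h @ 0^'+ --> a ->
  (\forall t \near 0^'+, h t <= (F (x + t *: d) - F x) / t) ->
  (a%:E <= clarke_dd F x d)%E.
Proof.
move=> ha hF; apply: le_ereal_inf_tmp => _ [V [[P Q] /= [Px Q0] PQV] <-].
apply/lee_addgt0Pr => e e0.
near (0 : R)^'+ => t.
have Vt : V (x, t).
  by apply: PQV; split => /=; [exact: nbhs_singleton|near: t].
apply: (@le_trans _ _ ((F (x + t *: d) - F x) / t + e)%:E); last first.
  by rewrite EFinD leeD2r//; apply: ereal_sup_ubound; exists (x, t).
have hF1 : h t <= (F (x + t *: d) - F x) / t by near: t.
have : `|a - h t| < e by near: t; exact: cvgr_dist_lt.
rewrite lee_fin ltr_norml => /andP[_]; lra.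
Unshelve. all: by end_near. Qed.

(* On the sphere the penalised function is at least F x, its value at the
   centre; hence a minimiser over the ball can be taken in the interior. *)
Lemma penalized_ball_min F x a rho :
  continuous F -> 0 < a ->
  (forall d, enorm d = 1 -> F x - rho <= F (x + a *: d)) ->
  exists2 z, enorm (z - x) < a & forall z', enorm (z' - x) <= a ->
    F z + rho / a ^+ 2 * dotv (z - x) (z - x) <=
    F z' + rho / a ^+ 2 * dotv (z' - x) (z' - x).
Proof.
move=> cF a0 Fsphere.
pose G z := F z + rho / a ^+ 2 * dotv (z - x) (z - x).
have cG : continuous G.
  move=> z; have zx : z' - x @[z' --> z] --> z - x.
    by apply: (@cvgB _ _ _ (nbhs z)); [exact: cvg_id|exact: cvg_cst].
  have := @cvgMl_tmp _ _ _ _ _ (rho / a ^+ 2) _ (cvg_dotv zx zx).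
  move=> /(_ (nbhs_filter z) (nbhs_filter z)); exact: (cvgD (cF z)).
have Bx : eball x a x by rewrite /eball /= subrr enorm0 ltW.
have cB := @compact_eball _ _ x a.
have [|z zB zmin] := EVT_min_rV _ cB (continuous_subspaceT cG).
  by exists x.
have {zB} za : enorm (z - x) <= a by move: zB; rewrite inE.
have {}zmin z' : enorm (z' - x) <= a -> G z <= G z'.
  by move=> ?; apply: zmin; rewrite inE.
move: za; rewrite le_eqVlt => /predU1P[za|za]; last by exists z.
exists x => [|z' z'a]; first by rewrite subrr enorm0.
apply: le_trans (zmin z' z'a).
rewrite subrr -sqr_enorm enorm0 expr0n mulr0 addr0 /G -sqr_enorm za.
rewrite divfK ?expf_neq0 ?gt_eqF//.
have := Fsphere (a^-1 *: (z - x)).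
rewrite enormZ ?invr_ge0 ?(ltW a0)// za mulVf ?gt_eqF// scalerA divff ?gt_eqF//.
by rewrite scale1r [x + _]addrC subrK => /(_ erefl); rewrite lerBlDr.
Qed.

(** Minimality of z for the penalised function bounds the difference quotients of F at z from below,
    up to a term linear in t. *)
Lemma goldstein_stationary_sphere F x a rho :
  continuous F -> 0 < a -> 0 <= rho ->
  (forall d, enorm d = 1 -> F x - rho <= F (x + a *: d)) ->
  goldstein_stationary a (2 * rho / a) F x.
Proof.
move=> cF a0 rho0 /(penalized_ball_min cF a0) [z za zmin].
pose k := rho / a ^+ 2; rewrite -/k in zmin.
have k0 : 0 <= k by rewrite divr_ge0 ?sqr_ge0.
exists ((2 * k) *: (x - z)); last first.
  rewrite enormZ; last by rewrite mulr_ge0.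
  have -> : enorm (x - z) = enorm (z - x).
    rewrite -[x - z]opprB /enorm; congr Num.sqrt.
    by apply: eq_bigr => i _; rewrite !mxE mulrNN.
  have -> : 2 * rho / a = 2 * k * a by rewrite /k; field; rewrite gt_eqF.
  by apply: ler_wpM2l; [exact: mulr_ge0|exact: ltW].
apply: sub_gen_smallest; exists z; first exact: ltW.
(* The minorant is k (|z - x|^2 - |z + t d - x|^2) / t, expanded. *)
move=> d; apply: (@clarke_dd_ge _ _ _ _
    (fun t => dotv ((2 * k) *: (x - z)) d - k * t * dotv d d)).
  have kt : k * t * dotv d d @[t --> 0^'+] --> k * 0 * dotv d d.
    apply: cvgMr_tmp; apply: cvgMl_tmp.
    by apply: cvg_at_right_filter; exact: cvg_id.
  rewrite mulr0 mul0r in kt; rewrite -[X in _ --> X]subr0.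
  by apply: cvgB kt; exact: cvg_cst.
(* As z is interior, z + t d stays in the ball for small t, where [zmin] applies. *)
have cpath : z + t *: d - x @[t --> 0^'+] --> z - x.
  apply: cvg_at_right_filter; apply: cvgB; last exact: cvg_cst.
  rewrite -[X in _ --> X]addr0; apply: cvgD; first exact: cvg_cst.
  by rewrite -(scale0r d); apply: cvgZr_tmp; exact: cvg_id.
have cenorm := cvg_comp _ _ cpath (@continuous_enorm R n (z - x)).
near=> t.
have t0 : 0 < t by near: t; exact: nbhs_right_gt.
have : enorm (z + t *: d - x) <= a.
  by apply: ltW; near: t; exact: (cvgr_lt _ cenorm).
move=> /zmin; rewrite -addrA [t *: d - x]addrC addrA.
rewrite ler_pdivlMr//.
have -> : x - z = (-1) *: (z - x) by rewrite scaleN1r opprB.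
rewrite !dotvDl !dotvDr !dotvZl !dotvZr !(dotvC d).
rewrite !dotvDl; lra.
Unshelve. all: by end_near. Qed.

End GoldsteinCriterion.

(** * Density of the tails of a dense sequence on the sphere *)

Section SphereDensity.
Context {R : realType} {n : nat}.

(** The column [u^T] has rank at most 1 < n, so its left kernel is nonzero. *)
Lemma orthogonal_nonzero (u : 'rV[R]_n) : (1 < n)%N ->
  exists2 v : 'rV[R]_n, v != 0 & dotv u v = 0.
Proof.
move=> n1.
have : kermx u^T != 0.
  rewrite -mxrank_eq0 mxrank_ker subn_eq0 -ltnNge.
  exact: leq_ltn_trans (rank_leq_col _) n1.
case/rowV0Pn => v /sub_kermxP uv v0; exists v => //.
move/matrixP/(_ ord0 ord0): uv; rewrite !mxE => <-.
by apply: eq_bigr => i _; rewrite !mxE mulrC.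
Qed.

(* For n >= 2 the sphere has no isolated point: the rational path
   w t = ((1 - q t^2) u + 2 t v) / (1 + q t^2), with v orthogonal to u and
   q = |v|^2, stays on the sphere, tends to u and is injective on t > 0. *)
Lemma dense_sphere_tail (dir : nat -> 'rV[R]_n) (N : nat) : (1 < n)%N ->
  esphere `<=` closure (range dir) ->
  esphere `<=` closure [set dir k | k in [set k | (N <= k)%N]].
Proof.
move=> n1 dense u u1 U Uu.
have [v v0 uv] := orthogonal_nonzero u n1.
have uu : dotv u u = 1 by rewrite -sqr_enorm u1 expr1n.
set q := dotv v v; have q0 : 0 < q by exact: dotvv_gt0.
pose w t := (1 + q * t ^+ 2)^-1 *: ((1 - q * t ^+ 2) *: u + (2 * t) *: v).
have den t : 0 < 1 + q * t ^+ 2.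
  by rewrite ltr_pwDl// mulr_ge0 ?sqr_ge0 ?ltW.
(* This is (1 - q t^2)^2 + 4 q t^2 = (1 + q t^2)^2. *)
have w1 t : enorm (w t) = 1.
  rewrite -(sqrtr1 R) /enorm; congr Num.sqrt.
  rewrite /w !(dotvZl, dotvZr, dotvDl, dotvDr) (dotvC v u) uv uu -/q.
  by field; rewrite gt_eqF.
(* The component along u alone determines t > 0, whence injectivity. *)
have wu t : dotv (w t) u = 2 / (1 + q * t ^+ 2) - 1.
  rewrite /w !(dotvZl, dotvDl) (dotvC v u) uv uu.
  by field; rewrite gt_eqF.
have w_inj s t : 0 < s -> 0 < t -> w s = w t -> s = t.
  move=> s0 t0 /(congr1 (dotv ^~ u)); rewrite !wu => /addIr.
  move=> /(mulfI (lt0r_neq0 (ltr0Sn R 1))) /invr_inj /addrI.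
  move=> /(mulfI (lt0r_neq0 q0)) /eqP.
  by rewrite eqrXn2 ?ltW// => /eqP.
have wcvg : w t @[t --> 0^'+] --> u.
  have q2 : q * t ^+ 2 @[t --> 0^'+] --> 0.
    have -> : nbhs (0 : R) = nbhs (q * 0 ^+ 2) by rewrite expr0n mulr0.
    apply: cvgMl_tmp; apply: cvg_at_right_filter.
    exact: (@exprn_continuous R 2 0).
  rewrite -[X in _ --> X](_ : 1^-1 *: ((1 - 0) *: u + (2 * 0) *: v) = u).
    apply: cvgZ.
      apply: cvgV; first exact: oner_neq0.
      by rewrite -[X in _ --> X]addr0; apply: cvgD => //; exact: cvg_cst.
    apply: cvgD; apply: cvgZr_tmp.
      by apply: cvgB => //; exact: cvg_cst.
    apply: cvgMl_tmp; apply: cvg_at_right_filter; exact: cvg_id.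
  by rewrite mulr0 scale0r addr0 subr0 invr1 !scale1r.
have wU : \forall t \near 0^'+, nbhs (w t) U.
  exact: (wcvg _ (nbhs_interior Uu)).
(* By injectivity each [dir j] is met for at most one t > 0, so for small t a whole neighbourhood of
   w t avoids the first M directions. *)
have wdir M : \forall t \near (0 : R)^'+,
    \forall w' \near w t, forall j, (j < M)%N -> w' <> dir j.
  elim: M => [|M IH]; first by near=> t; near=> w'.
  have HM : \forall t \near 0^'+, w t != dir M.
    have [[s [s0 ws]]|nws] := pselect (exists s, 0 < s /\ w s = dir M).
      near=> t; apply/eqP => wt.
      have t0 : 0 < t by [].
      have ts : t < s by near: t; exact: nbhs_right_lt.
      by move: ts; rewrite (w_inj t s) ?ltxx// wt ws.
    near=> t; apply/eqP => wt; apply: nws; exists t; split => //.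
  near=> t.
  have H1 : \forall w' \near w t, forall j, (j < M)%N -> w' <> dir j by near: t.
  have H2 : nbhs (w t) (~` [set dir M]).
    apply: open_nbhs_nbhs; split; last by apply/eqP; near: t.
    apply/closed_openC/accessible_closed_set1/hausdorff_accessible.
    exact: norm_hausdorff.
  apply: filterS2 H1 H2 => w' w'j w'M j.
  by rewrite ltnS leq_eqVlt => /predU1P[->//|]; exact: w'j.
near (0 : R)^'+ => t.
have U1 : nbhs (w t) U by near: t.
have U2 : \forall w' \near w t, forall j, (j < N)%N -> w' <> dir j.
  by near: t; exact: wdir.
(* Density is used at w t rather than at u: a direction found in U near w t cannot be among the
   first N. *)
have [_ [[k _ <-] [Uk kN]]] := dense _ (w1 t) _ (filterI U1 U2).
exists (dir k); split => //; exists k => //=.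
by rewrite leqNgt; apply/negP => /kN.
Unshelve. all: by end_near. Qed.

End SphereDensity.

(** * Eventual behaviour of a direct-search run *)

Section DirectSearchRun.
Context {R : realType}.

(** Infinitely many drops by [eta] would push [phi] below [lo]. It serves twice: for objective
    values and for stepsizes. *)
Lemma decrease_finite (phi : nat -> R) (P : nat -> Prop) (lo eta : R) :
  0 < eta -> (forall k, lo <= phi k) -> (forall k, phi k.+1 <= phi k) ->
  (forall k, P k -> phi k.+1 <= phi k - eta) ->
  exists K, forall k, (K <= k)%N -> ~ P k.
Proof.
move=> eta0 lo_phi phi_dec phiP; apply: contrapT => /forallNP noK.
have phi_le j k : (j <= k)%N -> phi k <= phi j.
  by elim: k => [|k IH]; rewrite leq_eqVlt => /predU1P[->//|// /IH];
    apply: le_trans.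
have drop m : exists k, phi k <= phi 0%N - eta *+ m.
  elim: m => [|m [k phik]]; first by exists 0%N; rewrite mulr0n subr0.
  have /existsNP[j /not_implyP[kj /contrapT Pj]] := noK k; exists j.+1.
  apply: le_trans (phiP _ Pj) _; rewrite mulrSr opprD addrA lerB//.
  exact: le_trans (phi_le _ _ kj) phik.
(* The number m of drops exceeds (phi 0 - lo) / eta. *)
have := archi_boundP (divr_ge0 (_ : 0 <= phi 0%N - lo) (ltW eta0)).
rewrite subr_ge0 => /(_ (lo_phi _)); set m := Num.bound _.
rewrite ltr_pdivrMr// => mlt; have [k phik] := drop m.
have := lo_phi k; rewrite leNgt => /negP; apply.
apply: le_lt_trans phik _; rewrite ltrBlDr -ltrBlDl.
by rewrite -mulr_natl.
Qed.

Context {n : nat}.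
Variables (Ft : 'rV[R]_n -> R) (alpha_min alpha0 theta gamma c lo : R).
Variables (x0 : 'rV[R]_n) (S D : nat -> set 'rV[R]_n).
Variables (x : nat -> 'rV[R]_n) (alpha : nat -> R).
Hypothesis run : ds_run Ft alpha_min theta gamma c x0 alpha0 S D x alpha.
Hypothesis (alpha_min_gt0 : 0 < alpha_min) (alpha0_ge : alpha_min <= alpha0).
Hypothesis (theta_lt1 : theta < 1) (c_gt0 : 0 < c).
Hypothesis Ft_ge : forall u, lo <= Ft u.

Lemma ds_run_alpha_ge k : alpha_min <= alpha k.
Proof.
have [_ a0 _ step] := run; elim: k => [|k IH]; first by rewrite a0.
case: (step k) => [_ _ /andP[+ _]|d _ _ _ _ /andP[+ _]|_ _ _ ->].
- exact: le_trans.
- exact: le_trans.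
- by rewrite le_max lexx.
Qed.

Lemma ds_run_eventually_unsuccessful : exists K, forall k, (K <= k)%N ->
  [/\ forall d, D k d -> ~ sufficient_decrease Ft c (x k) (alpha k)
                             (x k + alpha k *: d),
      x k.+1 = x k & alpha k.+1 = Num.max alpha_min (theta * alpha k)].
Proof.
have [_ _ _ step] := run.
(* A decrease guaranteed at every success, since stepsizes never fall below [alpha_min]. *)
pose eta := c / 2 * alpha_min ^+ 2.
have eta0 : 0 < eta by rewrite mulr_gt0 ?divr_gt0 ?exprn_gt0.
have etak k : eta <= c / 2 * alpha k ^+ 2.
  rewrite ler_wpM2l ?divr_ge0 ?(ltW c_gt0)//.
  by rewrite lerXn2r ?nnegrE ?(ltW alpha_min_gt0)// ?ds_run_alpha_ge//
    (le_trans (ltW alpha_min_gt0) (ds_run_alpha_ge k)).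
have dec k : Ft (x k.+1) <= Ft (x k) - eta \/
  [/\ forall d, D k d -> ~ sufficient_decrease Ft c (x k) (alpha k)
                             (x k + alpha k *: d),
      x k.+1 = x k & alpha k.+1 = Num.max alpha_min (theta * alpha k)].
  have ltk := etak k.
  case: (step k) => [_ + _|d _ _ + xk _|_ HD xk ak].
  - rewrite /sufficient_decrease; left; lra.
  - rewrite -xk /sufficient_decrease; left; lra.
  - by right.
have [|k|k|K HK] := @decrease_finite (Ft \o x)
  (fun k => Ft (x k.+1) <= Ft (x k) - eta) lo eta eta0.
- by move=> k; exact: Ft_ge.
- by rewrite /=; case: (dec k) => [|[_ -> _]] //; lra.
- by [].
- by exists K => k /HK; case: (dec k).
Qed.

(** Once all iterations fail, the iterate is frozen and the stepsize contracts down to its floor;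
    the inequality is the failure of the poll there. *)
Lemma ds_run_eventually_stationary : exists xbar K, forall k, (K <= k)%N ->
  [/\ x k = xbar, alpha k = alpha_min &
      forall d, D k d -> Ft xbar - c / 2 * alpha_min ^+ 2 <=
                         Ft (xbar + alpha_min *: d)].
Proof.
have [K HK] := ds_run_eventually_unsuccessful.
have xK k : x (K + k)%N = x K.
  elim: k => [|k IH]; first by rewrite addn0.
  by rewrite addnS -IH; have [] := HK _ (leq_addr k K).
have alphaE k : alpha (K + k).+1 = Num.max alpha_min (theta * alpha (K + k)%N).
  by have [] := HK _ (leq_addr k K).
(* Above the floor the new stepsize is theta alpha = alpha - (1 - theta) alpha, and alpha >=
   [alpha_min]. *)
have shrink k : alpha (K + k).+1 != alpha_min ->
    alpha (K + k).+1 <= alpha (K + k)%N - (1 - theta) * alpha_min.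
  rewrite alphaE; case: (leP alpha_min (theta * _)) => _; rewrite ?eqxx// => _.
  have : 0 <= (1 - theta) * (alpha (K + k)%N - alpha_min).
    by apply: mulr_ge0; rewrite subr_ge0 ?ds_run_alpha_ge// ltW.
  lra.
have eta0 : 0 < (1 - theta) * alpha_min by rewrite mulr_gt0 ?subr_gt0.
have [|k|k|J HJ] := @decrease_finite (fun k => alpha (K + k)%N)
  (fun k => alpha (K + k).+1 != alpha_min) alpha_min _ eta0.
- by move=> k; exact: ds_run_alpha_ge.
- have [E|/shrink] := eqVneq (alpha (K + k).+1) alpha_min.
    by rewrite addnS E ds_run_alpha_ge.
  by rewrite addnS; move: eta0; lra.
- by rewrite addnS; exact: shrink.
(* [HJ] controls the stepsize at the successor of K + j, hence the shift by one. *)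
exists (x K), (K + J).+1 => k Kk.
have [j kE Jj] : exists2 j, k = (K + j).+1 & (J <= j)%N.
  case: k Kk => // k; rewrite ltnS => KJk.
  have Kk := leq_trans (leq_addr J K) KJk.
  by exists (k - K)%N; rewrite ?subnKC ?leq_subRL.
have xk : x k = x K by rewrite kE -addnS xK.
have ak : alpha k = alpha_min by have /negP/negPn/eqP := HJ j Jj; rewrite -kE.
split=> // d Dd; rewrite -xk -ak leNgt; apply/negP.
have Kk' : (K <= k)%N by rewrite kE -addnS leq_addr.
by have [/(_ d Dd)] := HK k Kk'.
Qed.

End DirectSearchRun.

(** * Limit points of the iterates, and the conclusion *)

Lemma cluster_eventually_const {T : topologicalType} (u : nat -> T) (l : T)
    (K : nat) : hausdorff_space T ->
  (forall k, (K <= k)%N -> u k = l) -> cluster (u @ \oo) = [set l].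
Proof.
move=> hT uK.
have ul : u @ \oo --> l.
  by apply: cvg_near_cst; exists K.
apply/seteqP; split => [p up|_ ->].
  apply/esym/hT => A B Al Bp.
  exact: up _ _ (ul _ Al) Bp.
move=> A B uA lB; near \oo => k; exists l; split; last exact: nbhs_singleton.
rewrite -(uK k); last by near: k; exists K.
by near: k.
Unshelve. all: by end_near. Qed.

Unset Implicit Arguments.
Set Strict Implicit.

Theorem theorem3p1 (R : realType) (nx ny : nat)
  (f g : 'rV[R]_nx * 'rV[R]_ny -> R) (Z : set 'rV[R]_ny)
  (y ytilde : 'rV[R]_nx -> 'rV[R]_ny) (eps_oracle : R)
  (x0 : 'rV[R]_nx) (alpha_min alpha0 theta gamma c : R)
  (f_low L_f L_F : R)
  (S : nat -> set 'rV[R]_nx) (dir x : nat -> 'rV[R]_nx) (alpha : nat -> R)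
  (f_cont : continuous f)
  (y_argmin : forall u, argmin Z (fun z => g (u, z)) = [set y u])
  (eps_oracle_gt0 : 0 < eps_oracle)
  (oracle : forall u, enorm (ytilde u - y u) <= eps_oracle)
  (f_bounded : forall u z, f_low <= f (u, z))
  (L_f_gt0 : 0 < L_f)
  (f_lip : forall u z z', `|f (u, z) - f (u, z')| <= L_f * enorm (z - z'))
  (F_lip : elipschitz L_F (upper_objective f y))
  (alpha_min_gt0 : 0 < alpha_min) (alpha0_ge : alpha_min <= alpha0)
  (theta_itv : 0 < theta < 1) (gamma_ge1 : 1 <= gamma) (c_gt0 : 0 < c)
  (run : ds_run (upper_objective f ytilde) alpha_min theta gamma c
           x0 alpha0 S (fun k => [set dir k]) x alpha)
  (dir_unit : forall k, enorm (dir k) = 1)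
  (dir_dense : esphere `<=` closure (range dir))
  (* The sphere of R^1 is discrete, so density of the whole sequence does not
     pass to its tails there (it does as soon as nx >= 2). *)
  (dir_dense_dim1 : nx = 1%N -> forall N : nat,
     esphere `<=` closure [set dir k | k in [set k | (N <= k)%N]]) :
  exists xbar : 'rV[R]_nx,
    [/\ exists K : nat, forall k : nat, (K <= k)%N -> x k = xbar,
        cluster (x @ \oo) = [set xbar] &
        goldstein_stationary alpha_min
          (4 * L_f * eps_oracle / alpha_min + c * alpha_min)
          (upper_objective f y) xbar].
Proof.
have [xbar [K HK]] := ds_run_eventually_stationary run alpha_min_gt0 alpha0_ge
  (proj2 (andP theta_itv)) c_gt0 (fun u => f_bounded u (ytilde u)).
have xK k : (K <= k)%N -> x k = xbar by case/HK.
exists xbar; split; [by exists K|exact: cluster_eventually_const xK|].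
set F := upper_objective f y; set Ft := upper_objective f ytilde.
have FFt u : `|Ft u - F u| <= L_f * eps_oracle.
  by apply: le_trans (f_lip _ _ _) _; rewrite ler_pM2l.
(* The oracle error enters at both points compared by the poll; the rest is the decrease
   threshold. *)
pose rho := 2 * L_f * eps_oracle + c / 2 * alpha_min ^+ 2.
have -> : 4 * L_f * eps_oracle / alpha_min + c * alpha_min = 2 * rho / alpha_min.
  by rewrite /rho; field; rewrite gt_eqF.
have cF : continuous F by exact: elipschitz_continuous F_lip.
have nx0 := enorm1_dim_gt0 (dir_unit 0%N).
have dense_tail : esphere `<=` closure [set dir k | k in [set k | (K <= k)%N]].
  have [nx1|nx1] := leqP nx 1; last exact: dense_sphere_tail.
  by apply: dir_dense_dim1; apply/eqP; rewrite eqn_leq nx1.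
apply: goldstein_stationary_sphere => // [|d d1].
  by rewrite addr_ge0 ?mulr_ge0 ?exprn_ge0 ?divr_ge0 ?ltW.
(* A violation at d is an open condition, so it also holds at some [dir k] with k >= K, against the
   failed poll of iteration k. *)
rewrite leNgt; apply/negP => Fd.
have Fd_near : \forall e \near d, F (xbar + alpha_min *: e) < F xbar - rho.
  have cpath (e : 'rV[R]_nx) :
      xbar + alpha_min *: e' @[e' --> e] --> xbar + alpha_min *: e.
    apply: (@cvgD _ _ _ (nbhs e)); first exact: cvg_cst.
    exact: scaler_continuous.
  exact: (cvgr_lt _ (cvg_comp _ _ (cpath d) (cF _))).
have [_ [[k Kk <-] /= Fk]] := dense_tail d d1 _ Fd_near.
have [_ _ /(_ _ erefl)] := HK k Kk; rewrite -/Ft => Ftk.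
have := FFt xbar; have := FFt (xbar + alpha_min *: dir k).
rewrite !ler_norml => /andP[_ ?] /andP[? _].
by move: Fk Ftk; rewrite /rho; lra.
Qed.
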